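(* The equality relation $=$ is an equivalence relation on $\mathbb{CR}$. The relation $\succeq$ is a partial order on $\mathbb{CR}/{=}$.
   Context: Short cr-games (Cheating Robot games). The set $\mathbb{CR}$ of short cr-games (positions) is defined recursively. A position $G$ consists of a finite list $G(L)$ of $m\ge 0$ Left moves $G(i,\cdot)$, a finite list $G(R)$ of $n\ge 0$ Right moves $G(\cdot,j)$, and, for each $i$ a Left option $G^{i,\cdot}$, for each $j$ a Right option $G^{\cdot,j}$, and for each pair $(i,j)$ a same-round option $G^{i,j}$, all options being previously constructed positions. One writes $G=\{G^L\mid S(G)\mid G^R\}$, where $G^L$, $G^R$ are the lists of Left and Right options and $S(G)$ is the $m\times n$ matrix with entries $G^{i,j}$ ($S(G)=\emptyset$ if $m=0$ or $n=0$). The base case is $0=\{\,\cdot\mid\cdot\mid\cdot\,\}$ (no moves); a dot denotes an empty list. Outcomes. Play proceeds in rounds: from $G$, Left chooses a move $G(i,\cdot)$; then Right, knowing Left's choice, chooses $G(\cdot,j)$; the new position is $G^{i,j}$. If $S(G)=\emptyset$: $o(G)=\mathcal L$ (Left wins) if $G(L)\ne\emptyset$; $o(G)=\mathcal R$ (Right wins) if $G(R)\neq\emptyset$; otherwise $o(G)=\mathcal D$ (draw). If $S(G)\ne\emptyset$: $o(G)=\mathcal L$ if Left can force a win, $o(G)=\mathcal R$ if Right can force a win, otherwise $o(G)=\mathcal D$. Outcomes are totally ordered by $\mathcal L>\mathcal D>\mathcal R$. Disjunctive sum. $G+H$ has Left moves $G(i,\cdot)+H$ and $G+H(k,\cdot)$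 with Left options $G^{i,\cdot}+H$ and $G+H^{k,\cdot}$; Right moves $G(\cdot,j)+H$ and $G+H(\cdot,l)$ with Right options $G^{\cdot,j}+H$ and $G+H^{\cdot,l}$; and same-round options $G^{i,j}+H$ (both move in $G$), $G+H^{k,l}$ (both move in $H$), $G^{i,\cdot}+H^{\cdot,l}$ (Left in $G$, Right in $H$), $G^{\cdot,j}+H^{k,\cdot}$ (Left in $H$, Right in $G$). Equality and order. For $G,H\in\mathbb{CR}$: $G=H$ if $o(G+X)=o(H+X)$ for all $X\in\mathbb{CR}$; $G\succeq H$ if $o(G+X)\ge o(H+X)$ for all $X\in\mathbb{CR}$. *)

(* Defs.v *)
From HB Require Import structures.
From mathcomp Require Import all_boot all_order.
From Stdlib Require Relation_Definitions.
Set Implicit Arguments.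
Unset Strict Implicit.
Unset Printing Implicit Defensive.
Import Order.TTheory.
Local Open Scope order_scope.

(* [CRGame L R S] has m Left moves and n Right moves, the lists being indexed
   by ['I_m] and ['I_n]: [L i] is the Left option G^{i,.}, [R j] the Right
   option G^{.,j} and [S i j] the same-round option G^{i,j}.  The matrix S(G)
   is empty exactly when m = 0 or n = 0. *)
Inductive cr : Type :=
  CRGame (m n : nat)
    (L : 'I_m -> cr) (R : 'I_n -> cr) (S : 'I_m -> 'I_n -> cr).

Inductive outcome : Type := RightWins | Draw | LeftWins.

Definition outcome_rank (o : outcome) : nat :=
  match o with RightWins => 0 | Draw => 1 | LeftWins => 2 end.

Definition outcome_unrank (n : nat) : outcome :=
  match n with 0 => RightWins | 1 => Draw | _ => LeftWins end.

Lemma outcome_rankK : cancel outcome_rank outcome_unrank.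
Proof. by case. Qed.

HB.instance Definition _ := Choice.copy outcome (can_type outcome_rankK).

Definition outcome_le (x y : outcome) : bool :=
  (outcome_rank x <= outcome_rank y)%N.

Lemma outcome_le_anti : antisymmetric outcome_le.
Proof. by case; case. Qed.

Lemma outcome_le_trans : transitive outcome_le.
Proof. by case; case; case. Qed.

Lemma outcome_le_total : total outcome_le.
Proof. by case; case. Qed.

HB.instance Definition _ :=
  Order.isOrder.Build (Order.Disp tt tt) outcome
    (fun _ _ => erefl) (fun _ _ => erefl) (fun _ _ => erefl)
    outcome_le_anti outcome_le_trans outcome_le_total.

(* Within a round Right chooses knowing Left's choice, so Left needs one move
   good against every reply, and Right a reply to each Left move. *)
Fixpoint left_forces (G : cr) : bool :=
  let: CRGame m n _ _ SG := G in
  if (m == 0) || (n == 0) then m != 0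
  else [exists i : 'I_m, [forall j : 'I_n, left_forces (SG i j)]].

Fixpoint right_forces (G : cr) : bool :=
  let: CRGame m n _ _ SG := G in
  if (m == 0) || (n == 0) then n != 0
  else [forall i : 'I_m, [exists j : 'I_n, right_forces (SG i j)]].

Definition o (G : cr) : outcome :=
  if left_forces G then LeftWins
  else if right_forces G then RightWins
  else Draw.

(* [split] separates the moves in G ([inl]) from the moves in H ([inr]). *)
Fixpoint cr_add (G : cr) : cr -> cr :=
  let: CRGame mG nG LG RG SG := G in
  fix addG (H : cr) : cr :=
    let: CRGame mH nH LH RH SH := H in
    CRGame
      (fun a : 'I_(mG + mH) =>
         match split a with
         | inl i => cr_add (LG i) H
         | inr k => addG (LH k)
         end)
      (fun b : 'I_(nG + nH) =>
         match split b with
         | inl j => cr_add (RG j) H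
         | inr l => addG (RH l)
         end)
      (fun (a : 'I_(mG + mH)) (b : 'I_(nG + nH)) =>
         match split a, split b with
         | inl i, inl j => cr_add (SG i j) H
         | inr k, inr l => addG (SH k l)
         | inl i, inr l => cr_add (LG i) (RH l)
         | inr k, inl j => cr_add (RG j) (LH k)
         end).

Definition cr_eq (G H : cr) : Prop :=
  forall X : cr, o (cr_add G X) = o (cr_add H X).

Definition cr_ge (G H : cr) : Prop :=
  forall X : cr, o (cr_add G X) >= o (cr_add H X).

(* The quotient CR/=, as the type of equality classes; two classes with the
   same members are Leibniz-equal, by extensionality and proof irrelevance. *)
Definition cr_quot : Type := {C : cr -> Prop | exists G : cr, C = cr_eq G}.

Definition cr_class (G : cr) : cr_quot :=
  exist (fun C : cr -> Prop => exists G : cr, C = cr_eq G)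
        (cr_eq G) (ex_intro _ G erefl).

(* [C] >= [D] when some representatives are so related. *)
Definition cr_quot_ge (C D : cr_quot) : Prop :=
  exists G H : cr, [/\ sval C G, sval D H & cr_ge G H].

(* Main.v *)
Require Import Defs.
From mathcomp Require Import all_boot all_order.
From Stdlib Require Relation_Definitions.
From Stdlib Require Import FunctionalExtensionality PropExtensionality.
From Stdlib Require Import ProofIrrelevance.
Import Order.TTheory.

(** Both relations are pulled back from the totally ordered set of outcomes:
    a position [G] determines the function sending [X] to the outcome of
    [G + X], positions are equal when these functions agree pointwise, and [G]
    is at least [H] when the function of [G] dominates that of [H] pointwise.
    Pointwise equality is an equivalence relation and pointwise domination is
    a preorder; antisymmetry of the order on outcomes makes mutual domination
    the same as equality ([cr_ge_anti]).

    Domination is invariant under equality on both sides, so comparing two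
    classes through some representatives is comparing them through any
    ([cr_quot_geE]).  The order axioms on the quotient then come from the
    preorder on positions, once equal positions are known to have the same
    class ([cr_class_eq]). *)

Lemma cr_eq_refl G : cr_eq G G.
Proof. by move=> X. Qed.

Lemma cr_eq_sym G H : cr_eq G H -> cr_eq H G.
Proof. by move=> eGH X; rewrite eGH. Qed.

Lemma cr_eq_trans G H K : cr_eq G H -> cr_eq H K -> cr_eq G K.
Proof. by move=> eGH eHK X; rewrite eGH. Qed.

Lemma cr_eq_ge G H : cr_eq G H -> cr_ge G H.
Proof. by move=> eGH X; rewrite eGH. Qed.

Lemma cr_ge_trans G H K : cr_ge G H -> cr_ge H K -> cr_ge G K.
Proof. by move=> geGH geHK X; apply: le_trans (geHK X) (geGH X). Qed.

Lemma cr_ge_anti G H : cr_ge G H -> cr_ge H G -> cr_eq G H.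
Proof. by move=> geGH geHG X; apply: le_anti; rewrite geHG geGH. Qed.

(** The members of the class of [G] are the positions equal to [G], so by
    symmetry and transitivity equal positions have classes with the same
    members; extensionality identifies the predicates, and proof irrelevance
    the proofs that they are classes. *)
Lemma cr_class_eq G H : cr_eq G H -> cr_class G = cr_class H.
Proof.
move=> eGH; apply: subset_eq_compat.
apply: functional_extensionality => K; apply: propositional_extensionality.
by split; apply: cr_eq_trans => //; apply: cr_eq_sym.
Qed.

Lemma cr_class_surj (C : cr_quot) : exists G, C = cr_class G.
Proof.
by case: C => C [G defC]; exists G; apply: subset_eq_compat.
Qed.

(** The order on the quotient is well defined: replacing each representative
    by an equal position preserves domination. *)
Lemma cr_quot_geE G H : cr_quot_ge (cr_class G) (cr_class H) <-> cr_ge G H.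
Proof.
split=> [[G' [H' [/= eGG' eHH' geG'H']]] | geGH].
  apply: cr_ge_trans (cr_eq_ge _ _ eGG') _.
  by apply: cr_ge_trans geG'H' (cr_eq_ge _ _ (cr_eq_sym _ _ eHH')).
by exists G, H; split=> //; apply: cr_eq_refl.
Qed.

Theorem theorem2 :
  [/\ Relation_Definitions.equivalence cr cr_eq,
      forall G H : cr, cr_quot_ge (cr_class G) (cr_class H) <-> cr_ge G H
    & Relation_Definitions.order cr_quot cr_quot_ge].
Proof.
split; first by split; [exact: cr_eq_refl | exact: cr_eq_trans
                                          | exact: cr_eq_sym].
  exact: cr_quot_geE.
split=> [C | C D E | C D].
- have [G ->] := cr_class_surj C.
  by apply/cr_quot_geE/cr_eq_ge/cr_eq_refl.
- have [G ->] := cr_class_surj C; have [H ->] := cr_class_surj D.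
  have [K ->] := cr_class_surj E.
  move=> /cr_quot_geE geGH /cr_quot_geE geHK.
  by apply/cr_quot_geE/(cr_ge_trans _ _ _ geGH geHK).
- have [G ->] := cr_class_surj C; have [H ->] := cr_class_surj D.
  move=> /cr_quot_geE geGH /cr_quot_geE geHG.
  exact/cr_class_eq/cr_ge_anti.
Qed.
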